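(* Consider the two-color urn with sample size $m$ and replacement matrix $$Q_n=\begin{pmatrix}X_n & 0\\ 0 & X_n\end{pmatrix},$$ that is, $W_n=W_{n-1}+X_n\xi_n$ and $B_n=B_{n-1}+X_n(m-\xi_n)$ for $n\ge 1$. Then there exists a positive random variable $\tilde W_\infty$ such that, almost surely as $n\to\infty$, $$T_n=m\mu_X n+o(\sqrt n\,\ln(n)^\delta)\ \text{ for every }\delta>\tfrac12,\qquad W_n=\tilde W_\infty\, n+o(n),\qquad B_n=(m\mu_X-\tilde W_\infty)\,n+o(n).$$
   Context: Urn model: fix an integer $m\ge 1$. An urn contains white and blue balls; $W_n$, $B_n$ and $T_n=W_n+B_n$ denote the numbers of white balls, blue balls and all balls after $n$ steps, with $T_0=W_0+B_0\ge m$. Let $(X_n)$ be a sequence of strictly positive independent identically distributed discrete random variables with finite mean $\mu_X$ and finite variance. At step $n$ a sample of $m$ balls is drawn from the urn; $\xi_n$ is the number of white balls in the sample. The sample is returned together with additional balls whose numbers (white, blue) are given by the vector $Q_n(\xi_n,m-\xi_n)^t$, so that $(W_n,B_n)^t=(W_{n-1},B_{n-1})^t+Q_n(\xi_n,m-\xi_n)^t$. Let $\mathcal F_n$ be the $\sigma$-field generated by the first $n$ draws (samples and added balls). Then $\mathbb P[\xi_n=k\mid\mathcal F_{n-1}]=\binom{W_{n-1}}{k}\binom{B_{n-1}}{m-k}/\binom{T_{n-1}}{m}$, and $X_n$ is independent of $(\mathcal F_{n-1},\xi_n)$.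
   Formalization: If W_0=0 then W_n=0 for all n, so the limit is 0 and cannot be strictly positive; the formal theorem states that W̃_∞ is nonnegative in general and strictly positive whenever W_0>0, with all the asymptotics kept for every W_0, B_0. *)

(* Defs.v *)
From HB Require Import structures.
From mathcomp Require Export all_boot all_order all_algebra.
From mathcomp Require Export all_classical all_reals all_analysis.

Set Implicit Arguments.
Unset Strict Implicit.
Unset Printing Implicit Defensive.

Export Order.TTheory GRing.Theory Num.Theory.
Export numFieldNormedType.Exports.

Open Scope classical_set_scope.
Open Scope ring_scope.

Section conditioning.
Context (d : measure_display) (Omega : measurableType d) (R : realType).
Variable P : probability Omega R.
Implicit Types (F G : set (set Omega)) (E : set Omega) (f : Omega -> R).

Definition independent_systems F G : Prop :=
  forall A B, F A -> G B -> P (A `&` B) = (P A * P B)%E.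

(* [F] is meant to be a sub-sigma-algebra of the measurable sets. *)
Definition is_cond_proba F E f : Prop :=
  [/\ forall U : set R, measurable U -> F (f @^-1` U),
      P.-integrable setT (EFin \o f) &
      forall A, F A -> P (A `&` E) = (\int[P]_(w in A) (f w)%:E)%E].

Definition mutually_independent (X : nat -> {RV P >-> nat}) : Prop :=
  forall (s : seq nat) (A : nat -> set nat), uniq s ->
    P (\big[setI/setT]_(i <- s) (X i @^-1` A i)) =
    (\prod_(i <- s) P (X i @^-1` A i))%E.

Definition iid (X : nat -> {RV P >-> nat}) : Prop :=
  mutually_independent X /\
  forall i j (A : set nat), distribution P (X i) A = distribution P (X j) A.

End conditioning.

Definition hypergeometric (R : realType) (w b m k : nat) : R :=
  ('C(w, k) * 'C(b, m - k))%:R / 'C(w + b, m)%:R.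

Section urn.
Context (d : measure_display) (Omega : measurableType d) (R : realType).
Variable P : probability Omega R.

(* Steps are numbered from 1: X 0 and xi 0 play no role anywhere below. *)

(* The balls added at step i are (X i * xi i, X i * (m - xi i)); as m >= 1 and
   xi i <= m, the pair (xi i, X i) carries the same information as the pair
   (sample, added balls). *)
Definition draws_filtration (X xi : nat -> {RV P >-> nat}) (n : nat) :
    set (set Omega) :=
  <<s \bigcup_(i in `I_n) (g_sigma_algebra_preimage (X i.+1) `|`
                           g_sigma_algebra_preimage (xi i.+1)) >>.

Record multiple_drawing_urn (m W0 B0 : nat) (X xi : nat -> {RV P >-> nat})
    (W B T : nat -> Omega -> nat) : Prop := {
  urn_m_gt0 : (0 < m)%N ;
  urn_init_ge : (m <= W0 + B0)%N ;
  urn_W_init : forall w, W 0%N w = W0 ;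
  urn_B_init : forall w, B 0%N w = B0 ;
  urn_total : forall n w, T n w = (W n w + B n w)%N ;
  urn_sample_le : forall n w, (xi n.+1 w <= m)%N ;
  urn_W_step : forall n w, W n.+1 w = (W n w + X n.+1 w * xi n.+1 w)%N ;
  urn_B_step : forall n w, B n.+1 w = (B n w + X n.+1 w * (m - xi n.+1 w))%N ;
  urn_X_gt0 : forall n w, (0 < X n.+1 w)%N ;
  urn_X_iid : iid (fun n => X n.+1) ;
  urn_sample_law : forall n k, (k <= m)%N ->
    is_cond_proba P (draws_filtration X xi n) (xi n.+1 @^-1` [set k])
      (fun w => hypergeometric R (W n w) (B n w) m k) ;
  urn_X_indep : forall n,
    independent_systems P
      <<s draws_filtration X xi n `|` g_sigma_algebra_preimage (xi n.+1) >>
      (g_sigma_algebra_preimage (X n.+1)) }.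

End urn.

(* Main.v *)
Require Import Defs.
From HB Require Import structures.
From mathcomp Require Import measurable_realfun.
From mathcomp Require Import ring lra zify.

(** The total number of balls is T_n = T_0 + m (X_1 + ... + X_n), a random walk,
    and the proportion of white balls Z_n = W_n / T_n is a bounded martingale: if
    the sample is drawn without replacement, its mean number of white balls is
    m Z_n ([mean_hypergeometric]), so that whatever the value of X_(n+1) the added
    balls have the composition Z_n on average.  The theorem is W_n = Z_n T_n,
    B_n = T_n - W_n together with three almost sure facts.

    - T_n - m mu n = O(sqrt n (ln n)^delta) for each delta > 1/2
      ([total_deviation_bound]): Kolmogorov's maximal inequality bounds the
      probability that the walk exceeds sqrt(2^k) (k ln 2)^delta before time
      2^(k+1) by a multiple of k^(-2 delta), which is summable, and the
      Borel-Cantelli lemma applies.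

    - Z_n converges ([proportion_cvg]): as T_n >= m (n + 1), the increments of Z
      have second moments at most E[X^2] / (n + 1)^2, and the same maximal
      inequality bounds the probability that Z moves by eps after time N by
      E[X^2] / (N eps^2), whence Z is almost surely a Cauchy sequence.

    - If W_0 > 0 the limit is not 0 ([proportion_not_cvg0]): the nonnegative
      process - ln Z_n + c / W_n with c = 2 m^2 E[X^2] is a supermartingale.  The
      first term has a drift of at most m^2 E[X^2] / (W_n T_n); since a white ball
      is drawn with probability at least Z_n, the second one decreases on average
      by at least c / (2 W_n T_n), which is the same quantity.  By Fatou's lemma
      the lower limit of this process is almost surely finite, which rules out
      Z_n -> 0.

    Conditional expectations are never formed.  All draws are integers, so the
    first n of them take countably many values, and on the event that they are
    given the pair (X_(n+1), xi_(n+1)) has an explicit product law.  Summing over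
    these events, [one_step_expectation] computes the expectation of any
    nonnegative function of the first n + 1 draws. *)

Set Implicit Arguments.
Unset Strict Implicit.
Unset Printing Implicit Defensive.

(** * Random variables with countably many values *)

Section countable_valued.
Context d (Omega : measurableType d) (R : realType).
Variable P : probability Omega R.

(** Every preimage is the union of the fibres of c that it meets, and there are
    countably many of them. *)
Lemma countable_fibres_measurable d' (U : measurableType d') (C : countType)
    (c : Omega -> C) (f : Omega -> U) :
  (forall h, measurable [set w | c w = h]) ->
  (forall w w', c w = c w' -> f w = f w') -> measurable_fun setT f.
Proof.
move=> mc fc _ Y mY; rewrite setTI.
have -> : f @^-1` Y =
    \bigcup_(h in [set: C]) ([set w | c w = h] `&` f @^-1` Y).
  apply/seteqP; split=> [w Yw|w [h _ []]//].
  by exists (c w).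
apply: countable_bigcupT_measurable => [|h]; first exact: countableP.
have [->|/set0P[w0 [/= cw0 Yw0]]] := eqVneq ([set w | c w = h] `&` f @^-1` Y) set0.
  exact: measurable0.
suff -> : [set w | c w = h] `&` f @^-1` Y = [set w | c w = h] by [].
apply/seteqP; split=> [w []//|w /= cw]; split=> //=.
by rewrite (fc w w0)// cw cw0.
Qed.

(** This plays the role of the tower property: a statement on expectations
    conditional on c is a statement on the integrals over the fibres of c. *)
Lemma eq_integral_fibres (C : countType) (c : Omega -> C)
    (f g : Omega -> \bar R) :
  (forall h, measurable [set w | c w = h]) ->
  measurable_fun setT f -> measurable_fun setT g ->
  (forall w, 0 <= f w)%E -> (forall w, 0 <= g w)%E ->
  (forall w0, \int[P]_(w in [set w | c w = c w0]) f w =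
              \int[P]_(w in [set w | c w = c w0]) g w)%E ->
  (\int[P]_w f w = \int[P]_w g w)%E.
Proof.
move=> mc mf mg f0 g0 fg.
pose F j := [set w | pickle (c w) = j].
have FE j : F j = set0 \/ exists w0, F j = [set w | c w = c w0].
  have [->|/set0P[w0 Fw0]] := eqVneq (F j) set0; [by left|right].
  exists w0; apply/seteqP; split=> w /=.
  - by rewrite /F /= -Fw0 => /(pcan_inj pickleK).
  - by rewrite /F /= => ->.
have mF j : measurable (F j).
  by have [->|[w0 ->]] := FE j; [exact: measurable0|exact: mc].
have FT : \bigcup_j F j = setT.
  by apply/seteqP; split=> // w _; exists (pickle (c w)).
have tF : trivIset setT F.
  apply/trivIsetP => i j _ _ ij; apply/seteqP; split=> // w [/= wi wj].
  by move: ij; rewrite -wi -wj eqxx.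
rewrite -FT !ge0_integral_bigcup ?FT//.
apply: eq_eseriesr => j _.
by have [->|[w0 ->]] := FE j; rewrite ?integral_set0.
Qed.

Lemma measurable_preimage (Y : {RV P >-> nat}) k : measurable (Y @^-1` [set k]).
Proof. by rewrite -[_ @^-1` _]setTI; exact: measurable_funP. Qed.

Lemma integral_nat_valued (Y : {RV P >-> nat}) (D : set Omega) (g : nat -> R) :
  measurable D -> (forall x, 0 <= g x) ->
  (\int[P]_(w in D) (g (Y w))%:E =
   \sum_(0 <= x <oo) (g x)%:E * P (D `&` Y @^-1` [set x]))%E.
Proof.
move=> mD g0.
pose F x := D `&` Y @^-1` [set x].
have mF x : measurable (F x).
  by apply: measurableI => //; exact: measurable_preimage.
have FT : \bigcup_x F x = D.
  by apply/seteqP; split=> [w [x _ []]//|w Dw]; exists (Y w).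
have tF : trivIset setT F.
  apply/trivIsetP => i j _ _ ij; apply/seteqP; split=> // w [[_ /= wi] [_ /= wj]].
  by move: ij; rewrite -wi -wj eqxx.
rewrite -{1}FT ge0_integral_bigcup//.
- apply: eq_eseriesr => x _.
  rewrite (eq_integral (cst (g x)%:E)) ?integral_cst// => w.
  by rewrite inE => -[_ /= ->].
- rewrite FT; apply/measurable_EFinP/(@measurableT_comp _ _ _ _ _ _ g) => //.
  by apply: (@measurable_funS _ _ _ _ setT).
- by move=> w _; rewrite lee_fin.
Qed.

End countable_valued.

(** * Moments of the hypergeometric law *)

Section hypergeometric_moments.
Variables (R : realType) (m w b : nat).

Lemma hypergeometric_ge0 k : 0 <= hypergeometric R w b m k.
Proof. by rewrite /hypergeometric divr_ge0. Qed.

Hypothesis m_le : (m <= w + b)%N.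

Lemma sum_hypergeometric : \sum_(k < m.+1) hypergeometric R w b m k = 1.
Proof.
rewrite /hypergeometric -mulr_suml -natr_sum binomial.Vandermonde divff//.
by rewrite pnatr_eq0 -lt0n bin_gt0.
Qed.

(** By k C(w, k) = w C(w - 1, k - 1), the sum is again a Vandermonde
    convolution. *)
Lemma mean_hypergeometric :
  \sum_(k < m.+1) hypergeometric R w b m k * k%:R =
  m%:R * (w%:R / (w + b)%:R).
Proof.
case: m m_le => [|n] n_le; first by rewrite big_ord1 mulr0 mul0r.
have C0 : ('C(w + b, n.+1))%:R != 0 :> R by rewrite pnatr_eq0 -lt0n bin_gt0.
have wb0 : (w + b)%:R != 0 :> R.
  by rewrite pnatr_eq0 -lt0n (leq_trans _ n_le).
suff : (\sum_(k < n.+2) 'C(w, k) * 'C(b, n.+1 - k) * k * (w + b) =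
        n.+1 * w * 'C(w + b, n.+1))%N.
  move/(congr1 (fun x => x%:R : R)); rewrite natr_sum => mean.
  apply: (mulIf wb0); apply: (mulIf C0).
  rewrite mulrA divfK// -natrM -natrM -mean !mulr_suml.
  apply: eq_bigr => k _; rewrite /hypergeometric !natrM.
  by field.
rewrite big_ord_recl /= muln0 mul0n add0n.
under eq_bigr => j _.
  rewrite /bump add1n subSS.
  have -> : ('C(w, j.+1) * 'C(b, n - j) * j.+1 * (w + b) =
             w * (w + b) * ('C(w.-1, j) * 'C(b, n - j)))%N.
    transitivity (j.+1 * 'C(w, j.+1) * ('C(b, n - j) * (w + b)))%N; first by ring.
    by rewrite -mul_bin_diag; ring.
  over.
rewrite -big_distrr /= binomial.Vandermonde -!mulnA (mulnCA n.+1).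
by case: w => [//|v]; rewrite -mul_bin_diag addSn.
Qed.

End hypergeometric_moments.

(** * The one-step law of the urn *)

Section urn_process.
Context (d : measure_display) (Omega : measurableType d) (R : realType).
Variables (P : probability Omega R) (m W0 B0 : nat) (X xi : nat -> {RV P >-> nat}).
Variables (W B T : nat -> Omega -> nat).
Hypothesis urn : multiple_drawing_urn m W0 B0 X xi W B T.

Definition history n w := mkseq (fun i => (X i.+1 w, xi i.+1 w)) n.

(** Adaptedness is stated on values and not on sigma-algebras: it is then proved
    by substitution, and it implies measurability because there are countably many
    histories ([adapted_measurable]). *)
Definition adapted n (Y : Type) (f : Omega -> Y) :=
  forall w w', history n w = history n w' -> f w = f w'.

Lemma historyS n w :
  history n.+1 w = rcons (history n w) (X n.+1 w, xi n.+1 w).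
Proof. exact: mkseqS. Qed.

Lemma historyS_eq n w w' : history n.+1 w = history n.+1 w' ->
  [/\ history n w = history n w', X n.+1 w = X n.+1 w'
    & xi n.+1 w = xi n.+1 w'].
Proof. by rewrite !historyS => /rcons_inj[]. Qed.

Lemma adaptedS n (Y : Type) (f : Omega -> Y) : adapted n f -> adapted n.+1 f.
Proof. by move=> fa w w' /historyS_eq[/fa]. Qed.

Lemma adapted_next n (Y : Type) (f : Omega -> nat -> nat -> Y) :
  adapted n f -> adapted n.+1 (fun w => f w (X n.+1 w) (xi n.+1 w)).
Proof. by move=> fa w w' /historyS_eq[/fa -> -> ->]. Qed.

(** The initial composition is deterministic, hence the composition is a function
    of the draws. *)
Lemma adapted_WB n : adapted n (fun w => (W n w, B n w)).
Proof.
elim: n => [|n IH] w w' hw; first by rewrite !(urn_W_init urn, urn_B_init urn).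
have [/IH[Wn Bn] Xn xin] := historyS_eq hw.
by rewrite !(urn_W_step urn, urn_B_step urn) Wn Bn Xn xin.
Qed.

Lemma draws_filtrationS n :
  draws_filtration X xi n `<=` draws_filtration X xi n.+1.
Proof.
apply: sub_sigma_algebra2 => A [i /= lt_in Ai]; exists i => //=.
exact: ltnW.
Qed.

Lemma draws_filtrationI n A C : draws_filtration X xi n A ->
  draws_filtration X xi n C -> draws_filtration X xi n (A `&` C).
Proof. exact: (@measurableI _ (g_sigma_algebraType _)). Qed.

Lemma preimage_g_sigma_algebra (Y : {RV P >-> nat}) k :
  g_sigma_algebra_preimage Y (Y @^-1` [set k]).
Proof. by exists [set k] => //; rewrite setTI. Qed.

Lemma draws_filtration_history n h :
  draws_filtration X xi n [set w | history n w = h].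
Proof.
elim: n h => [|n IH] h.
  have [<-|neq] := eqVneq [::] h.
    rewrite (_ : [set _ | _] = setT); last by apply/seteqP; split.
    exact: (@measurableT _ (g_sigma_algebraType _)).
  rewrite (_ : [set _ | _] = set0); first exact: (@measurable0 _ (g_sigma_algebraType _)).
  by apply/seteqP; split=> // w /= /eqP; rewrite (negbTE neq).
case/lastP: h => [|h [x k]].
  rewrite (_ : [set _ | _] = set0); first exact: (@measurable0 _ (g_sigma_algebraType _)).
  by apply/seteqP; split=> // w /=; rewrite historyS => /(congr1 size); rewrite size_rcons.
rewrite (_ : [set _ | _] = [set w | history n w = h] `&`
    (X n.+1 @^-1` [set x] `&` xi n.+1 @^-1` [set k])).
  apply: draws_filtrationI; first exact: draws_filtrationS.
  apply: draws_filtrationI; apply: sub_sigma_algebra; exists n => //=; [left|right];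
    exact: preimage_g_sigma_algebra.
apply/seteqP; split=> w /=; first by rewrite historyS => /rcons_inj[-> -> ->].
by move=> [<- [<- <-]]; rewrite historyS.
Qed.

Lemma measurable_history n h : measurable [set w | history n w = h].
Proof.
have sub : draws_filtration X xi n `<=` measurable.
  apply: smallest_sub; first exact: sigma_algebra_measurable.
  by move=> A [i _ [|] [Y mY <-]]; exact: measurable_funP.
by apply: sub; exact: draws_filtration_history.
Qed.

Lemma adapted_measurable n d' (U : measurableType d') (f : Omega -> U) :
  adapted n f -> measurable_fun setT f.
Proof. exact/countable_fibres_measurable/measurable_history. Qed.

(** The conditional law of the sample, integrated over the event that the first n
    draws are those of w0, on which the composition of the urn is constant. *)
Lemma sample_law n k w0 : (k <= m)%N ->
  P ([set w | history n w = history n w0] `&` xi n.+1 @^-1` [set k]) =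
  ((hypergeometric R (W n w0) (B n w0) m k)%:E *
    P [set w | history n w = history n w0])%E.
Proof.
move=> k_le; have [_ _ ->] := urn_sample_law urn n k_le.
  rewrite -integral_cst; last exact: measurable_history.
  by apply: eq_integral => w; rewrite inE /= => /adapted_WB[-> ->].
exact: draws_filtration_history.
Qed.

Lemma X_law n x : P (X n.+1 @^-1` [set x]) = P (X 1%N @^-1` [set x]).
Proof. exact: (urn_X_iid urn).2 n 0%N [set x]. Qed.

Lemma X_independent n k h x :
  P ([set w | history n w = h] `&` xi n.+1 @^-1` [set k] `&` X n.+1 @^-1` [set x]) =
  (P ([set w | history n w = h] `&` xi n.+1 @^-1` [set k]) *
   P (X 1%N @^-1` [set x]))%E.
Proof.
rewrite -(X_law n); apply: (urn_X_indep urn); last exact: preimage_g_sigma_algebra.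
apply: (@measurableI _ (g_sigma_algebraType _)); apply: sub_sigma_algebra.
- by left; exact: draws_filtration_history.
- by right; exact: preimage_g_sigma_algebra.
Qed.

(** The mean of f w x k over the number k of white balls in the next sample, for a
    fixed value x of the replacement factor. *)
Definition next_mean n (f : Omega -> nat -> nat -> R) w x :=
  \sum_(k < m.+1) hypergeometric R (W n w) (B n w) m k * f w x k.

(** On the event that the first n draws are given, the next sample is
    hypergeometric, and X_(n+1) is independent of it with the law of X_1; the
    variable w' is an independent copy of the randomness of X_(n+1). *)
Lemma one_step_expectation n (f : Omega -> nat -> nat -> R) :
  adapted n f -> (forall w x k, (k <= m)%N -> 0 <= f w x k) ->
  (\int[P]_w (f w (X n.+1 w) (xi n.+1 w))%:E =
   \int[P]_w \int[P]_w' (next_mean n f w (X 1%N w'))%:E)%E.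
Proof.
move=> fa f0.
have nm0 w x : 0 <= next_mean n f w x.
  apply: sumr_ge0 => k _; rewrite mulr_ge0 ?hypergeometric_ge0// f0//.
  by rewrite -ltnS.
have nma : adapted n (next_mean n f).
  by move=> w w' hw; rewrite /next_mean; have [-> ->] := adapted_WB hw; rewrite (fa _ _ hw).
apply: (eq_integral_fibres (measurable_history n)) => [| |w|w|w0].
- apply/measurable_EFinP/(@adapted_measurable n.+1).
  exact: (adapted_next fa).
- apply: (@adapted_measurable n) => w w' /nma nmw.
  by rewrite nmw.
- by rewrite lee_fin f0// (urn_sample_le urn).
- by apply: integral_ge0 => w' _; rewrite lee_fin.
(* From here on the first n draws are those of w0; A is split according to the
   value of the next sample, then according to the value of X_(n+1). *)
set A := [set w | _]; have mA : measurable A by exact: measurable_history.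
pose F (k : nat) := A `&` xi n.+1 @^-1` [set k].
have mF k : measurable (F k) by apply: measurableI => //; exact: measurable_preimage.
transitivity (\sum_(k < m.+1) \int[P]_(w in F k) (f w0 (X n.+1 w) k)%:E)%E.
  have FT : \big[setU/set0]_(k <- index_iota 0 m.+1) F k = A.
    rewrite -bigcup_seq; apply/seteqP; split=> [w [k _ []]//|w Aw].
    exists (xi n.+1 w) => //=.
    by rewrite mem_index_iota /= ltnS (urn_sample_le urn).
  have tF : trivIset [set` index_iota 0 m.+1] F.
    apply/trivIsetP => i j _ _ ij; apply/seteqP; split=> // w [[_ /= wi] [_ /= wj]].
    by move: ij; rewrite -wi -wj eqxx.
  rewrite -FT ge0_integral_bigsetU ?FT//; first last.
  - by move=> w _; rewrite lee_fin f0// (urn_sample_le urn).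
  - apply: measurable_funTS; apply/measurable_EFinP/(@adapted_measurable n.+1).
    exact: (adapted_next fa).
  - exact: iota_uniq.
  rewrite big_mkord; apply: eq_bigr => k _; apply: eq_integral => w.
  by rewrite inE => -[/= Aw <-]; rewrite (fa _ _ Aw).
transitivity (\int[P]_(w in A) cst (\int[P]_w' (next_mean n f w0 (X 1%N w'))%:E) w)%E; last first.
  by apply: eq_integral => w; rewrite inE => /nma nmw /=; rewrite nmw.
rewrite integral_cst// /next_mean.
under [X in (_ = X * _)%E]eq_integral do rewrite -sumEFin.
rewrite ge0_integral_sum//; last 2 first.
  by move=> k; apply/measurable_EFinP/measurable_funM => //; exact: (@measurableT_comp _ _ _ _ _ _ (f w0 ^~ k)).
  by move=> k w' _; rewrite lee_fin mulr_ge0 ?hypergeometric_ge0// f0// -ltnS.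
rewrite ge0_sume_distrl; last first.
  by move=> k _; apply: integral_ge0 => w' _; rewrite lee_fin mulr_ge0 ?hypergeometric_ge0// f0// -ltnS.
apply: eq_bigr => k _.
under [X in (_ = X * _)%E]eq_integral do rewrite EFinM.
have k_le : (k <= m)%N by rewrite -ltnS.
rewrite ge0_integralZl//; last 3 first.
  by apply/measurable_EFinP; exact: (@measurableT_comp _ _ _ _ _ _ (f w0 ^~ k)).
  by move=> w' _; rewrite lee_fin f0.
  by rewrite lee_fin hypergeometric_ge0.
rewrite (@integral_nat_valued _ _ _ _ (X n.+1) _ (fun x => f w0 x k))//; last by move=> x; exact: f0.
rewrite (@integral_nat_valued _ _ _ _ (X 1%N) _ (fun x => f w0 x k))//; last by move=> x; exact: f0.
rewrite muleAC -sample_law// -/A -/(F k).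
rewrite -[P (F k)]fineK ?fin_num_measure// -nneseriesZl => [|x _].
  apply: eq_eseriesr => x _.
  by rewrite fineK ?fin_num_measure// setTI X_independent muleCA.
by rewrite mule_ge0 ?lee_fin ?f0.
Qed.

Lemma total_step n w : T n.+1 w = (T n w + m * X n.+1 w)%N.
Proof.
rewrite !(urn_total urn) (urn_W_step urn) (urn_B_step urn).
have := urn_sample_le urn n w; nia.
Qed.

(** Each X_i is at least 1.  The bound starts from T_0 >= m and has the factor
    n + 1, so that it never degenerates. *)
Lemma total_ge n w : (m * n.+1 <= T n w)%N.
Proof.
elim: n => [|n IH].
  by rewrite (urn_total urn) (urn_W_init urn) (urn_B_init urn) muln1 (urn_init_ge urn).
rewrite total_step mulnS addnC leq_add// -[leqLHS]muln1 leq_mul2l.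
by rewrite (urn_X_gt0 urn) orbT.
Qed.

Lemma sample_le_total n w : (m <= W n w + B n w)%N.
Proof.
by rewrite -(urn_total urn) (leq_trans _ (total_ge n w))// leq_pmulr.
Qed.

Lemma next_mean_cst n (f : Omega -> nat -> nat -> R) w x c :
  (forall k, (k <= m)%N -> f w x k = c) -> next_mean n f w x = c.
Proof.
move=> fc; rewrite /next_mean.
rewrite (eq_bigr (fun k : 'I_m.+1 => hypergeometric R (W n w) (B n w) m k * c)); last first.
  by move=> k _; rewrite fc// -ltnS.
by rewrite -mulr_suml sum_hypergeometric ?mul1r ?sample_le_total.
Qed.

End urn_process.

(** * Moments of the replacement factor *)

Section urn_moments.
Context (d : measure_display) (Omega : measurableType d) (R : realType).
Variables (P : probability Omega R) (m W0 B0 : nat) (X xi : nat -> {RV P >-> nat}).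
Variables (W B T : nat -> Omega -> nat) (muX : R).
Hypothesis urn : multiple_drawing_urn m W0 B0 X xi W B T.
Hypothesis X_mean : ('E_P[fun w => (X 1%N w)%:R] = muX%:E)%E.
Hypothesis X_variance : ('V_P[fun w => (X 1%N w)%:R] < +oo)%E.

Let X1 w : R := (X 1%N w)%:R.
Definition second_moment : R := fine (\int[P]_w (X1 w ^+ 2)%:E)%E.

Lemma measurable_X1 (g : nat -> R) : measurable_fun setT (fun w => g (X 1%N w)).
Proof. exact: measurableT_comp. Qed.

Lemma X1_mean : (\int[P]_w (X1 w)%:E = muX%:E)%E.
Proof. by rewrite -X_mean unlock. Qed.

Lemma centered_square_integrable :
  P.-integrable setT (fun w => ((X1 w - muX) ^+ 2)%:E).
Proof.
apply/integrableP; split.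
  by apply/measurable_EFinP; apply: (measurable_X1 (fun x => (x%:R - muX) ^+ 2)).
under eq_integral do rewrite gee0_abs ?lee_fin ?sqr_ge0//.
move: X_variance; rewrite /variance unlock X_mean unlock.
by congr (_ < _)%E; apply: eq_integral => w _; rewrite expr2.
Qed.

Lemma X1_integrable : P.-integrable setT (fun w => (X1 w)%:E).
Proof.
apply/integrableP; split; first by apply/measurable_EFinP/(measurable_X1 (fun x => x%:R)).
under eq_integral do rewrite gee0_abs ?lee_fin ?ler0n//.
by rewrite X1_mean ltry.
Qed.

(** X^2 = (X - mu)^2 + 2 mu X - mu^2, and the variance is finite. *)
Lemma X1_square_integrable : P.-integrable setT (fun w => (X1 w ^+ 2)%:E).
Proof.
rewrite (_ : (fun _ => _) = (fun w => ((X1 w - muX) ^+ 2)%:E +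
    ((2 * muX)%:E * (X1 w)%:E - (muX ^+ 2)%:E))%E); last first.
  by apply/funext => w; rewrite -EFinM -EFinB -EFinD; congr EFin; ring.
apply: integrableD => //; first exact: centered_square_integrable.
apply: integrableB => //; last exact: finite_measure_integrable_cst.
exact/integrableZl/X1_integrable.
Qed.

Lemma X1_square_mean : (\int[P]_w (X1 w ^+ 2)%:E = second_moment%:E)%E.
Proof. by rewrite fineK// integrable_fin_num// X1_square_integrable. Qed.

Lemma quadratic_mean (p0 p1 p2 : R) :
  (\int[P]_w (p0 + p1 * X1 w + p2 * X1 w ^+ 2)%:E =
    (p0 + p1 * muX + p2 * second_moment)%:E)%E.
Proof.
under eq_integral do rewrite !EFinD !EFinM.
have i0 : P.-integrable setT (fun=> p0%:E) by exact: finite_measure_integrable_cst.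
have i1 : P.-integrable setT (fun w => p1%:E * (X1 w)%:E)%E.
  exact/integrableZl/X1_integrable.
have i2 : P.-integrable setT (fun w => p2%:E * (X1 w ^+ 2)%:E)%E.
  exact/integrableZl/X1_square_integrable.
rewrite integralD//; last exact: integrableD.
rewrite integralD// !integralZl//; last 2 first.
- exact: X1_square_integrable.
- exact: X1_integrable.
have := expectation_cst P p0; rewrite unlock => ->.
by rewrite X1_mean X1_square_mean.
Qed.

Lemma second_moment_ge0 : 0 <= second_moment.
Proof. by apply/fine_ge0/integral_ge0 => w _; rewrite lee_fin sqr_ge0. Qed.

Lemma muX_ge1 : 1 <= muX.
Proof.
rewrite -lee_fin -X1_mean -(@probability_setT _ _ _ P) -[leLHS]mul1e.
rewrite -(integral_cst P measurableT); apply: ge0_le_integral => //.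
- by apply/measurable_EFinP/(measurable_X1 (fun x => x%:R)).
- by move=> w _ /=; rewrite lee_fin ler1n (urn_X_gt0 urn 0).
Qed.

Lemma variance_second_moment :
  second_moment - muX ^+ 2 = fine (\int[P]_w ((X1 w - muX) ^+ 2)%:E)%E.
Proof.
rewrite (_ : (\int[P]_w _)%E =
   (\int[P]_w (muX ^+ 2 + (- 2 * muX) * X1 w + 1 * X1 w ^+ 2)%:E)%E).
  by rewrite quadratic_mean /=; ring.
by apply: eq_integral => w _; congr EFin; ring.
Qed.

Lemma centered_second_moment_ge0 : 0 <= second_moment - muX ^+ 2.
Proof.
by rewrite variance_second_moment; apply/fine_ge0/integral_ge0 => w _; rewrite lee_fin sqr_ge0.
Qed.

(** A sufficient condition for the conditional mean of f given the first n draws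
    to be at most c.  The mean over the sample is computed first, for each value x
    of X_(n+1); a bound for it that is quadratic in x is then integrated by means
    of the first two moments of X.  The condition asks for nothing at x = 0, a
    value that X_(n+1) does not take. *)
Definition one_step_le n (f : Omega -> nat -> nat -> R) w (c : R) :=
  exists p : R * R * R,
    (forall x, (0 < x)%N ->
      next_mean m W B n f w x <= p.1.1 + p.1.2 * x%:R + p.2 * x%:R ^+ 2) /\
    p.1.1 + p.1.2 * muX + p.2 * second_moment <= c.

Lemma one_step_expectation_le n (f : Omega -> nat -> nat -> R) (g : Omega -> R) :
  adapted X xi n f -> (forall w x k, (k <= m)%N -> 0 <= f w x k) ->
  measurable_fun setT g ->
  (forall w, one_step_le n f w (g w)) ->
  (\int[P]_w (f w (X n.+1 w) (xi n.+1 w))%:E <= \int[P]_w (g w)%:E)%E.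
Proof.
move=> fa f0 mg fg; rewrite (one_step_expectation urn fa f0).
have nm0 w x : 0 <= next_mean m W B n f w x.
  apply: sumr_ge0 => k _; rewrite mulr_ge0 ?hypergeometric_ge0// f0//.
  by rewrite -ltnS.
apply: ge0_le_integral => //.
- by move=> w _; apply: integral_ge0 => w' _; rewrite lee_fin.
- apply: (@adapted_measurable _ _ _ _ X xi n) => w w' hw.
  by rewrite /next_mean; have [-> ->] := adapted_WB urn hw; rewrite (fa _ _ hw).
- exact/measurable_EFinP.
move=> w _; have [[[p0 p1] p2] [/= fp pg]] := fg w.
apply: le_trans (_ : (p0 + p1 * muX + p2 * second_moment)%:E <= _)%E; last by rewrite lee_fin.
rewrite -quadratic_mean; apply: ge0_le_integral => //.
- by move=> w' _; rewrite lee_fin.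
- by apply/measurable_EFinP/(measurable_X1 (next_mean m W B n f w)).
- by apply/measurable_EFinP/(measurable_X1 (fun x => p0 + p1 * x%:R + p2 * x%:R ^+ 2)).
- by move=> w' _; rewrite lee_fin fp// (urn_X_gt0 urn).
Qed.

End urn_moments.

(** * A maximal inequality *)

Section maximal.
Context (d : measure_display) (Omega : measurableType d) (R : realType).
Variables (P : probability Omega R) (m W0 B0 : nat) (X xi : nat -> {RV P >-> nat}).
Variables (W B T : nat -> Omega -> nat) (muX : R).
Hypothesis urn : multiple_drawing_urn m W0 B0 X xi W B T.
Hypothesis X_mean : ('E_P[fun w => (X 1%N w)%:R] = muX%:E)%E.
Hypothesis X_variance : ('V_P[fun w => (X 1%N w)%:R] < +oo)%E.
Local Notation q := (second_moment X).
Local Notation adapted := (adapted X xi).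

(** Y is a square-integrable martingale with increments D.  That D is centred and
    has conditional second moment at most v is expressed by the single condition
    [D_mean], which is what the proof of Kolmogorov's inequality consumes. *)
Section maximal_inequality.
Variables (Y : nat -> Omega -> R) (D : nat -> Omega -> nat -> nat -> R).
Variable v : nat -> R.
Hypothesis Y_step : forall n w, Y n.+1 w = Y n w + D n w (X n.+1 w) (xi n.+1 w).
Hypothesis Y_adapted : forall n, adapted n (Y n).
Hypothesis D_adapted : forall n, adapted n (D n).
Hypothesis v_ge0 : forall n, 0 <= v n.
Hypothesis D_mean : forall n w a,
  one_step_le m X W B muX n (fun w x k => (a + D n w x k) ^+ 2) w (a ^+ 2 + v n).

Variables (N : nat) (lambda : R).
Hypothesis lambda_gt0 : 0 < lambda.

(** The martingale Y (N + j) - Y N, stopped at the first time when its absolute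
    value reaches lambda.  That it ever did so can be read off from the last value,
    which reduces the maximal inequality to a Markov inequality. *)
Fixpoint stopped j w : R :=
  if j is i.+1 then
    if lambda <= `|stopped i w| then stopped i w else Y (N + i.+1) w - Y N w
  else 0.

Lemma stoppedE j w : `|stopped j w| < lambda -> stopped j w = Y (N + j) w - Y N w.
Proof.
case: j => [|j] /=; first by rewrite addn0 subrr.
by case: ifPn => // ge; rewrite ltNge ge.
Qed.

Lemma stopped_le i j w : (i <= j)%N -> lambda <= `|stopped i w| -> lambda <= `|stopped j w|.
Proof.
move=> /subnK <- ge; elim: (j - i)%N => [|k IH]; first by rewrite add0n.
by rewrite addSn /= IH.
Qed.

Lemma stopped_ge j w : lambda <= `|Y (N + j) w - Y N w| -> lambda <= `|stopped j w|.
Proof.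
by move=> ge; rewrite leNgt; apply/negP => lt; have := lt;
  rewrite (stoppedE lt) ltNge ge.
Qed.

Lemma adaptedD n k (f : Omega -> R) : adapted n f -> adapted (n + k) f.
Proof. by move=> fa; elim: k => [|k IH]; rewrite ?addn0// addnS; exact: adaptedS. Qed.

Lemma stopped_adapted j : adapted (N + j) (stopped j).
Proof.
elim: j => [|j IH] w w' hw //=.
have [hw' _ _] : [/\ history X xi (N + j) w = history X xi (N + j) w',
    X (N + j).+1 w = X (N + j).+1 w' & xi (N + j).+1 w = xi (N + j).+1 w'].
  by apply: historyS_eq; rewrite -addnS.
by rewrite (IH _ _ hw') (Y_adapted hw) (adaptedD (@Y_adapted N) hw).
Qed.

Lemma stopped_square j :
  (\int[P]_w (stopped j w ^+ 2)%:E <= (\sum_(i < j) v (N + i))%:E)%E.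
Proof.
elim: j => [|j IH].
  rewrite big_ord0; under eq_integral do rewrite /= expr0n /=.
  by rewrite integral0.
rewrite big_ord_recr /= EFinD.
(* f is the square of the next value of the stopped process, as a function of
   the next draw. *)
pose f w x k := if lambda <= `|stopped j w| then stopped j w ^+ 2
                else (stopped j w + D (N + j) w x k) ^+ 2.
have ms : measurable_fun setT (fun w => stopped j w ^+ 2).
  by apply: (@adapted_measurable _ _ _ _ X xi (N + j)) => w w' /stopped_adapted ->.
under eq_integral => w _.
  rewrite (_ : (if _ then _ else _) ^+ 2 = f w (X (N + j).+1 w) (xi (N + j).+1 w)).
    over.
  rewrite /f; case: ifPn => //; rewrite -ltNge => /stoppedE ->.
  by rewrite addnS Y_step; congr (_ ^+ 2); ring.
apply: le_trans (_ : \int[P]_w (stopped j w ^+ 2 + v (N + j))%:E <= _)%E.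
  apply: (one_step_expectation_le urn X_mean X_variance) => [w w' hw|w x k _||w].
  - by rewrite /f (stopped_adapted hw) (D_adapted hw).
  - by rewrite /f; case: ifP => _; exact: sqr_ge0.
  - by apply: measurable_funD.
  have [ge|lt] := boolP (lambda <= `|stopped j w|).
    exists (stopped j w ^+ 2, 0, 0); split=> [x _ /=|/=].
      by rewrite (next_mean_cst urn _ (c := stopped j w ^+ 2)) ?mul0r ?addr0// => k _; rewrite /f ge.
    by rewrite !mul0r !addr0 lerDl.
  have [p [px pq]] := D_mean (N + j) w (stopped j w).
  exists p; split=> // x /px; apply: le_trans.
  by rewrite /next_mean /f (negbTE lt).
under eq_integral do rewrite EFinD.
rewrite ge0_integralD//; last 3 first.
- by move=> w _; rewrite lee_fin sqr_ge0.
- exact/measurable_EFinP.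
- by move=> w _; rewrite lee_fin.
rewrite leeD//.
by have := expectation_cst P (v (N + j)); rewrite unlock => ->.
Qed.

Lemma stopped_markov j :
  (P [set w | lambda <= `|stopped j w|]%R <=
    ((\sum_(i < j) v (N + i)) / lambda ^+ 2)%:E)%E.
Proof.
have l2 : 0 < lambda ^+ 2 by rewrite exprn_gt0.
have ms : measurable_fun setT (fun w => stopped j w ^+ 2).
  by apply: (@adapted_measurable _ _ _ _ X xi (N + j)) => w w' /stopped_adapted ->.
have ms' : measurable_fun setT (fun w => (stopped j w ^+ 2)%:E) by exact/measurable_EFinP.
have := le_integral_abse P measurableT ms' l2.
rewrite (_ : _ `&` _ = [set w | lambda <= `|stopped j w|]%R); last first.
  rewrite setTI; apply/seteqP; split=> w /=;
    by rewrite lee_fin [`|_ ^+ 2|]ger0_norm ?sqr_ge0// -(real_normK (num_real (stopped j w))) ler_pXn2r// nnegrE ltW.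
move=> le; rewrite EFinM lee_pdivlMr// muleC (le_trans le)//.
under eq_integral do rewrite gee0_abs ?lee_fin ?sqr_ge0//.
exact: stopped_square.
Qed.

Lemma stopped_measurable j : measurable [set w | lambda <= `|stopped j w|].
Proof.
rewrite -[X in measurable X]setTI.
apply: (@adapted_measurable _ _ _ _ X xi (N + j) _ _ (fun w => lambda <= `|stopped j w|) _ measurableT [set true]) => //.
by move=> w w' /stopped_adapted ->.
Qed.

(** Kolmogorov's maximal inequality.  The event E is that the stopped process ends
    above lambda, which is measurable because that process is adapted. *)
Lemma maximal_inequality J : exists E : set Omega, [/\ measurable E,
  (P E <= ((\sum_(i < J) v (N + i)) / lambda ^+ 2)%:E)%E &
  forall w i, (i <= J)%N -> lambda <= `|Y (N + i) w - Y N w| -> E w].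
Proof.
exists [set w | lambda <= `|stopped J w|]; split.
- exact: stopped_measurable.
- exact: stopped_markov.
- by move=> w i iJ /stopped_ge; exact: stopped_le.
Qed.

(** With summable variances the exceptional events increase with the horizon, and
    continuity from below gives the same bound for all times. *)
Lemma maximal_inequality_oo V : (forall J, \sum_(i < J) v (N + i) <= V) ->
  exists E : set Omega, [/\ measurable E, (P E <= (V / lambda ^+ 2)%:E)%E &
  forall w i, lambda <= `|Y (N + i) w - Y N w| -> E w].
Proof.
move=> vV; pose E J := [set w | lambda <= `|stopped J w|].
exists (\bigcup_J E J); split.
- by apply: bigcupT_measurable => J; exact: stopped_measurable.
- have cvgE : (P \o E) J @[J --> \oo] --> P (\bigcup_J E J).
    apply: nondecreasing_cvg_mu.
    + by move=> J; exact: stopped_measurable.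
    + by apply: bigcupT_measurable => J; exact: stopped_measurable.
    + by move=> i j ij; apply/subsetPset => w /=; exact: stopped_le.
  rewrite -(cvg_lim _ cvgE)//; apply: lime_le; first by apply/cvg_ex; eexists; exact: cvgE.
  apply: nearW => J /=; rewrite (le_trans (stopped_markov J))// lee_fin.
  by rewrite ler_pM2r ?invr_gt0 ?exprn_gt0.
- by move=> w i /stopped_ge ge; exists i.
Qed.

End maximal_inequality.

End maximal.

(** * Auxiliary estimates *)

Lemma negligible_small d (Omega : measurableType d) (R : realType)
    (P : {measure set Omega -> \bar R}) (A : set Omega) :
  (forall e : R, 0 < e ->
    exists E, [/\ measurable E, (P E <= e%:E)%E & A `<=` E]) -> P.-negligible A.
Proof.
move=> small.
have inv_gt0 n : 0 < n.+1%:R^-1 :> R by rewrite invr_gt0 ltr0n.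
pose E n := projT1 (cid (small _ (inv_gt0 n))).
have EP n : [/\ measurable (E n), (P (E n) <= n.+1%:R^-1%:E)%E & A `<=` E n].
  by rewrite /E; case: cid.
have mE : measurable (\bigcap_n E n).
  by apply: bigcapT_measurable => n; have [] := EP n.
exists (\bigcap_n E n); split => //; last first.
  by move=> w Aw n _; have [_ _] := EP n; exact.
apply/eqP; rewrite eq_le measure_ge0 andbT; apply/lee_addgt0Pr => e e0.
rewrite add0e; near \oo => n.
have [mEn PEn _] := EP n.
apply: (@le_trans _ _ (P (E n))).
  by apply: le_measure; rewrite ?inE//; exact: bigcap_inf.
rewrite (le_trans PEn)// lee_fin ltW//.
by near: n; exact: near_infty_natSinv_lt (PosNum e0).
Unshelve. all: by end_near. Qed.

(** Telescoping: 1 / (k + 1)^2 <= 1 / k - 1 / (k + 1). *)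
Lemma sum_inv_square_le (R : realFieldType) N J : (0 < N)%N ->
  \sum_(i < J) ((N + i).+1%:R ^+ 2)^-1 <= N%:R^-1 - (N + J)%:R^-1 :> R.
Proof.
move=> N0; elim: J => [|J IH]; first by rewrite big_ord0 addn0 subrr.
rewrite big_ord_recr /= (le_trans (lerD IH (lexx _)))//.
rewrite addnS -addrA lerD2l.
have : 0 < (N + J)%:R :> R by rewrite ltr0n addn_gt0 N0.
rewrite -natr1; move: (N + J)%:R => /= y y0.
rewrite -subr_ge0 (_ : _ - _ = (y * (y + 1) ^+ 2)^-1); last first.
  by field; rewrite !gt_eqF// addr_gt0.
by rewrite invr_ge0 mulr_ge0 ?sqr_ge0// ltW.
Qed.

(** The pointwise inequality behind the supermartingale - ln Z + c / W, where
    Z = w / t and c = 2 m^2 q.  The last term is linear in k - m Z and vanishes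
    once averaged over the sample; the term with x^2 - q vanishes once averaged
    over X when q = E[X^2]. *)
Lemma potential_step_le (R : realType) (m k x : nat) (w t q : R) :
  (0 < m)%N -> (k <= m)%N -> (0 < x)%N -> 1 <= w -> w <= t -> 0 <= q ->
  - ln ((w + x%:R * k%:R) / (t + m%:R * x%:R)) +
    2 * m%:R ^+ 2 * q / (w + x%:R * k%:R) <=
  - ln (w / t) + 2 * m%:R ^+ 2 * q / w +
    m%:R ^+ 2 / (w * t) * (x%:R ^+ 2 - q) +
    ((x%:R ^+ 2 - q) * m%:R / w ^+ 2 - x%:R / w) * (k%:R - m%:R * (w / t)).
Proof.
move=> m0 km x0 w1 wt q0.
have {m0}m1 : 1 <= m%:R :> R by rewrite ler1n.
have {x0}x1 : 1 <= x%:R :> R by rewrite ler1n.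
have k0 : 0 <= k%:R :> R by [].
have {}km : k%:R <= m%:R :> R by rewrite ler_nat.
move: m%:R k%:R x%:R m1 x1 k0 km => M K Y M1 Y1 K0 KM.
have w0 : 0 < w by lra.
have t0 : 0 < t by lra.
have YK0 : 0 <= Y * K by rewrite mulr_ge0//; lra.
have MY0 : 0 <= M * Y by rewrite mulr_ge0//; lra.
have w'0 : 0 < w + Y * K by lra.
have t'0 : 0 < t + M * Y by lra.
have wt0 : 0 < w / t by rewrite divr_gt0.
have ratio0 : 0 < (w + Y * K) / (t + M * Y) by rewrite divr_gt0.
(* ln y <= y - 1 at the ratio y of the old proportion to the new one *)
have lnle : - ln ((w + Y * K) / (t + M * Y)) <=
    - ln (w / t) + (w / t / ((w + Y * K) / (t + M * Y)) - 1).
  rewrite -lerBlDl opprK addrC -ln_div ?posrE//.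
  rewrite -[X in ln X](subrK 1) [X in ln X]addrC le_ln1Dx//.
  by rewrite ltrBrDl subrr divr_gt0.
have drift : w / t / ((w + Y * K) / (t + M * Y)) - 1 <=
    Y / w * (M * (w / t) - K) + Y ^+ 2 * K * M / w ^+ 2.
  rewrite -subr_ge0 (_ : _ - _ = Y ^+ 2 * K *
     (M * (w / t) * w + (M - K) * w + M * (Y * K)) / (w ^+ 2 * (w + Y * K))).
    apply: divr_ge0; last by rewrite mulr_ge0 ?sqr_ge0// ltW.
    have a0 : 0 <= M * (w / t) * w.
      by rewrite mulr_ge0 ?(ltW w0)// mulr_ge0 ?(ltW wt0)//; lra.
    have b0 : 0 <= (M - K) * w by rewrite mulr_ge0 ?(ltW w0)//; lra.
    have c0 : 0 <= M * (Y * K) by rewrite mulr_ge0//; lra.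
    by rewrite mulr_ge0 ?mulr_ge0 ?sqr_ge0//; lra.
  by field; lra.
(* for k = 0 this is an equality; for k >= 1 it says that drawing white balls
   makes c / W decrease *)
have growth : 2 * M ^+ 2 * q / (w + Y * K) <=
    2 * M ^+ 2 * q / w - q * M * K / w ^+ 2.
  rewrite -subr_ge0 (_ : _ - _ = q * M * K * (2 * M * Y * w - w - Y * K) /
     (w ^+ 2 * (w + Y * K))); last by field; lra.
  have : 0 <= 2 * M * Y * w - w - Y * K.
    have MY1 : Y <= M * Y by rewrite ler_peMl//; lra.
    have : M * Y <= M * Y * w by rewrite ler_peMr//; lra.
    have : w <= M * Y * w by rewrite ler_peMl//; lra.
    have : Y * K <= Y * M by rewrite ler_wpM2l//; lra.
    by lra.
  move=> num; apply: divr_ge0; last by rewrite mulr_ge0 ?sqr_ge0// ltW.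
  by rewrite mulr_ge0// mulr_ge0// mulr_ge0//; lra.
apply: le_trans (lerD lnle growth) _; apply: le_trans (lerD (lerD (lexx _) drift) (lexx _)) _.
rewrite -subr_ge0 (_ : _ - _ = 0)//; field; lra.
Qed.

(** * The proportion of white balls *)

Section proportion.
Context (d : measure_display) (Omega : measurableType d) (R : realType).
Variables (P : probability Omega R) (m W0 B0 : nat) (X xi : nat -> {RV P >-> nat}).
Variables (W B T : nat -> Omega -> nat) (muX : R).
Hypothesis urn : multiple_drawing_urn m W0 B0 X xi W B T.
Hypothesis X_mean : ('E_P[fun w => (X 1%N w)%:R] = muX%:E)%E.
Hypothesis X_variance : ('V_P[fun w => (X 1%N w)%:R] < +oo)%E.
Local Notation q := (second_moment X).
Local Notation adapted := (adapted X xi).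

Definition proportion n w : R := (W n w)%:R / (T n w)%:R.

Lemma total_gt0 n w : (0 < T n w)%N.
Proof. by rewrite (leq_trans _ (total_ge urn n w))// muln_gt0 (urn_m_gt0 urn). Qed.

Lemma white_le_total n w : (W n w <= T n w)%N.
Proof. by rewrite (urn_total urn) leq_addr. Qed.

Lemma proportion_ge0 n w : 0 <= proportion n w.
Proof. by rewrite divr_ge0. Qed.

Lemma proportion_le1 n w : proportion n w <= 1.
Proof. by rewrite ler_pdivrMr ?ltr0n ?total_gt0// mul1r ler_nat white_le_total. Qed.

Lemma adapted_WT n : adapted n (fun w => (W n w, T n w)).
Proof.
by move=> w w' hw; rewrite !(urn_total urn); have [-> ->] := adapted_WB urn hw.
Qed.

Lemma proportion_adapted n : adapted n (proportion n).
Proof. by move=> w w' hw; rewrite /proportion; have [-> ->] := adapted_WT hw. Qed.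

(** The number of white balls in the sample has mean m Z_n, so that the linear
    term averages to zero.  This is the only way in which the sampling law enters
    the study of Z. *)
Lemma next_mean_affine_le n (f : Omega -> nat -> nat -> R) w x (a b : R) :
  (forall k, (k <= m)%N ->
    f w x k <= a + b * (k%:R - m%:R * proportion n w)) ->
  next_mean m W B n f w x <= a.
Proof.
move=> fab; have mle := sample_le_total urn n w.
rewrite (_ : a = \sum_(k < m.+1) hypergeometric R (W n w) (B n w) m k *
    (a + b * (k%:R - m%:R * proportion n w))).
  apply: ler_sum => k _; rewrite ler_wpM2l ?hypergeometric_ge0// fab//.
  by rewrite -ltnS.
rewrite (eq_bigr (fun k : 'I_m.+1 =>
    (a - b * (m%:R * proportion n w)) * hypergeometric R (W n w) (B n w) m k +
    b * (hypergeometric R (W n w) (B n w) m k * k%:R))); last first.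
  by move=> k _; ring.
rewrite big_split/= -!mulr_sumr sum_hypergeometric// mean_hypergeometric//.
by rewrite -(urn_total urn) mulr1 subrK.
Qed.

Definition proportion_increment n w (x k : nat) : R :=
  (W n w + x * k)%:R / (T n w + m * x)%:R - proportion n w.

Lemma proportion_step n w :
  proportion n.+1 w = proportion n w + proportion_increment n w (X n.+1 w) (xi n.+1 w).
Proof.
by rewrite /proportion_increment addrC subrK /proportion (urn_W_step urn) (total_step urn).
Qed.

Lemma proportion_incrementE n w x k : proportion_increment n w x k =
  x%:R / (T n w + m * x)%:R * (k%:R - m%:R * proportion n w).
Proof.
rewrite /proportion_increment /proportion !natrD !natrM.
have t0 : 0 < (T n w)%:R :> R by rewrite ltr0n total_gt0.
have mx0 : 0 <= m%:R * x%:R :> R by rewrite mulr_ge0.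
by field; rewrite !gt_eqF// ltr_wpDr.
Qed.

(** The factor k - m Z_n is at most m in absolute value, and T_n >= m (n + 1). *)
Lemma proportion_increment_le n w x k : (k <= m)%N ->
  proportion_increment n w x k ^+ 2 <= x%:R ^+ 2 / n.+1%:R ^+ 2.
Proof.
move=> km; rewrite proportion_incrementE -expr_div_n -ler_sqrt ?sqr_ge0//.
rewrite !sqrtr_sqr normrM [leRHS]ger0_norm// ger0_norm//.
have t0 : 0 < (T n w)%:R :> R by rewrite ltr0n total_gt0.
have dev : `|k%:R - m%:R * proportion n w| <= m%:R.
  rewrite ler_norml.
  have z0 := proportion_ge0 n w; have z1 := proportion_le1 n w.
  have mz : m%:R * proportion n w <= m%:R by rewrite ler_piMr.
  have mz0 : 0 <= m%:R * proportion n w by rewrite mulr_ge0.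
  have {km} : k%:R <= m%:R :> R by rewrite ler_nat.
  have : 0 <= k%:R :> R by [].
  by move=> ? ?; apply/andP; split; lra.
apply: (le_trans (ler_wpM2l _ dev)) => //.
rewrite -mulrA ler_wpM2l// mulrC ler_pdivrMr ?ltr0n ?addn_gt0 ?total_gt0//.
rewrite mulrC ler_pdivlMr ?ltr0n// -natrM ler_nat.
by rewrite (leq_trans (total_ge urn n w))// leq_addr.
Qed.

Lemma proportion_increment_mean n w a :
  one_step_le m X W B muX n (fun w x k => (a + proportion_increment n w x k) ^+ 2)
    w (a ^+ 2 + q / n.+1%:R ^+ 2).
Proof.
exists (a ^+ 2, 0, (n.+1%:R ^+ 2)^-1); split=> [x _|]; last first.
  by rewrite /= mul0r addr0 [_ * q]mulrC.
apply: (@next_mean_affine_le _ _ _ _ _ (2 * a * (x%:R / (T n w + m * x)%:R))) => k km /=.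
have := proportion_increment_le n w x km.
rewrite -(mulrA (2 * a)) -proportion_incrementE; move: (proportion_increment _ _ _ _) => D le.
rewrite mul0r addr0 (_ : (a + D) ^+ 2 = a ^+ 2 + D ^+ 2 + 2 * a * D); last by ring.
by rewrite lerD2r lerD2l mulrC.
Qed.

Lemma adapted_increment n : adapted n (proportion_increment n).
Proof.
move=> w w' hw; rewrite /proportion_increment (proportion_adapted hw).
by have [-> ->] := adapted_WT hw.
Qed.

Lemma q_ge0 : 0 <= q. Proof. exact: second_moment_ge0. Qed.

(** Outside the event of probability at most q / (N eps^2) given by the maximal
    inequality, Z moves by less than eps after time N.  As N is arbitrary, almost
    surely there is such an N for each eps. *)
Lemma proportion_cvg : {ae P, forall w, cvgn (proportion ^~ w)}.
Proof.
have cauchy_k (k : nat) : {ae P, forall w, exists N, forall i,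
    `|proportion (N + i) w - proportion N w| < k.+1%:R^-1}.
  apply: (@negligible_small _ _ _ P) => e e0.
  have k0 : 0 < k.+1%:R^-1 :> R by rewrite invr_gt0.
  near \oo => N.
  have N0 : (0 < N)%N by near: N; exact: nbhs_infty_gt.
  have [||E [mE PE EP]] := maximal_inequality_oo urn X_mean X_variance
    proportion_step proportion_adapted adapted_increment
    (v := fun n => q / n.+1%:R ^+ 2) _ proportion_increment_mean (N := N) k0
    (V := q / N%:R).
  - by move=> n; rewrite divr_ge0// ?q_ge0// exprn_ge0.
  - move=> J; rewrite -mulr_sumr ler_wpM2l ?q_ge0//.
    by rewrite (le_trans (sum_inv_square_le _ _ N0))// gerBl invr_ge0.
  exists E; split => //.
  - rewrite (le_trans PE)// lee_fin.
    rewrite exprVn invrK mulrAC ler_pdivrMr ?ltr0n// -ler_pdivrMl//.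
    by near: N; exact: nbhs_infty_ger.
  - move=> w /= /forallNP nE.
    have /existsNP[i] := nE N.
    by move/negP; rewrite -leNgt => /EP.
have := ae_foralln cauchy_k.
apply: filterS => w cw.
apply: cauchy_cvg; apply: cauchy_exP => e e0.
near \oo => k.
have [N NP] := cw k.
exists (proportion N w); exists N => // n /= Nn.
rewrite -(subnKC Nn) /ball /= distrC (lt_trans (NP _))//.
by near: k; exact: near_infty_natSinv_lt (PosNum e0).
Unshelve. all: by end_near. Qed.

Hypothesis W0_gt0 : (0 < W0)%N.

Lemma white_gt0 n w : (0 < W n w)%N.
Proof.
elim: n => [|n IH]; first by rewrite (urn_W_init urn).
by rewrite (urn_W_step urn) addn_gt0 IH.
Qed.

(** The term - ln Z is a submartingale only, with a drift of order 1 / (W T).  The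
    multiple of 1 / W compensates this drift. *)
Definition potential n w : R :=
  - ln (proportion n w) + 2 * m%:R ^+ 2 * q / (W n w)%:R.

Lemma potential_adapted n : adapted n (potential n).
Proof.
by move=> w w' hw; rewrite /potential (proportion_adapted hw); have [->] := adapted_WT hw.
Qed.

Lemma potential_coef_ge0 : 0 <= 2 * m%:R ^+ 2 * q.
Proof. by rewrite mulr_ge0 ?q_ge0// mulr_ge0// sqr_ge0. Qed.

Lemma potential_ge0 n w : 0 <= potential n w.
Proof.
rewrite addr_ge0// ?oppr_ge0 ?ln_le0 ?proportion_le1//.
by rewrite divr_ge0// potential_coef_ge0.
Qed.

Lemma potential_measurable n : measurable_fun setT (fun w => (potential n w)%:E).
Proof.
by apply: (@adapted_measurable _ _ _ _ X xi n) => w w' /potential_adapted ->.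
Qed.

Lemma potential_supermartingale n :
  (\int[P]_w (potential n.+1 w)%:E <= \int[P]_w (potential n w)%:E)%E.
Proof.
pose f w (x k : nat) : R := - ln ((W n w + x * k)%:R / (T n w + m * x)%:R) +
  2 * m%:R ^+ 2 * q / (W n w + x * k)%:R.
under eq_integral => w _.
  rewrite (_ : potential n.+1 w = f w (X n.+1 w) (xi n.+1 w)).
    over.
  by rewrite /potential /proportion (urn_W_step urn) (total_step urn).
apply: (one_step_expectation_le urn X_mean X_variance) => [w w' hw|w x k km||w].
- by rewrite /f; have [-> ->] := adapted_WT hw.
- rewrite addr_ge0// ?oppr_ge0; last by rewrite divr_ge0// potential_coef_ge0.
  rewrite ln_le0// ler_pdivrMr ?ltr0n ?addn_gt0 ?total_gt0//.
  by rewrite mul1r ler_nat leq_add ?white_le_total// mulnC leq_mul.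
- by apply/measurable_EFinP; exact: potential_measurable.
(* the coefficients of 1 and x^2 left by [potential_step_le] after averaging over
   the sample: they cancel when x^2 is replaced by its mean q *)
pose wt : R := (W n w)%:R * (T n w)%:R.
exists (potential n w - m%:R ^+ 2 / wt * q, 0, m%:R ^+ 2 / wt); split=> [x x0|/=].
  apply: (next_mean_affine_le (b := (x%:R ^+ 2 - q) * m%:R / (W n w)%:R ^+ 2 - x%:R / (W n w)%:R)) => k km /=.
  rewrite /f !natrD !natrM (le_trans (potential_step_le (urn_m_gt0 urn) km x0 _ _ q_ge0))//.
  - by rewrite ler1n white_gt0.
  - by rewrite ler_nat white_le_total.
  - rewrite lerD2r mul0r addr0 -/(proportion n w) -/(potential n w) -[leRHS]addrA lerD2l.
    by rewrite mulrBr addrC.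
by rewrite mul0r addr0 subrK.
Qed.

(** If Z_n -> 0 then the potential tends to infinity, whereas its lower limit has
    finite expectation by Fatou's lemma. *)
Lemma proportion_not_cvg0 : {ae P, forall w, ~ (proportion n w @[n --> \oo] --> 0)}.
Proof.
have w0 : Omega := point.
have bound n : (\int[P]_w (potential n w)%:E <= (potential 0 w0)%:E)%E.
  elim: n => [|n IH]; last exact: le_trans (potential_supermartingale n) IH.
  have := expectation_cst P (potential 0 w0); rewrite unlock => <-.
  rewrite le_eqVlt; apply/orP; left; apply/eqP; apply: eq_integral => w _.
  by rewrite (@potential_adapted 0 w w0).
have mliminf : measurable_fun setT (fun w => limn_einf (fun n => (potential n w)%:E)).
  apply: measurableT_comp; first exact: oppe_measurable.
  apply: measurable_fun_limn_esup => n.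
  by apply: measurableT_comp; [exact: oppe_measurable|exact: potential_measurable].
have : P.-integrable setT (fun w => limn_einf (fun n => (potential n w)%:E)).
  apply/integrableP; split => //.
  under eq_integral => w _.
    rewrite gee0_abs; last first.
      rewrite limn_einf_lim lime_ge//; first exact: is_cvg_einfs.
      apply: nearW => n; apply: le_ereal_inf_tmp => _ [k _ <-].
      by rewrite lee_fin potential_ge0.
    over.
  apply: le_lt_trans (fatou _ measurableT potential_measurable _) _.
    by move=> n w _; rewrite lee_fin potential_ge0.
  apply: (@le_lt_trans _ _ (potential 0 w0)%:E); last exact: ltry.
  rewrite limn_einf_lim lime_le//; first exact: is_cvg_einfs.
  apply: nearW => n; apply: le_trans (bound n).
  by apply: ereal_inf_lbound; exists n => /=.
move/(integrable_ae measurableT); apply: filterS => w /(_ I) fin cvg0.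
suff : (potential n w)%:E @[n --> \oo] --> +oo%E.
  by move/cvg_limn_einf_sup => -[lim _]; rewrite lim in fin.
apply/cvgeyPge => A.
have /cvgrPdist_le/(_ _ (expR_gt0 (- A))) := cvg0.
apply: filterS => n; rewrite sub0r normrN ger0_norm ?proportion_ge0// => le.
rewrite lee_fin (@le_trans _ _ (- ln (proportion n w)))//; last first.
  by rewrite lerDl divr_ge0// potential_coef_ge0.
rewrite lerNr -[leRHS]expRK ler_ln ?posrE ?expR_gt0//.
by rewrite divr_gt0// ltr0n ?white_gt0 ?total_gt0.
Qed.

End proportion.

(** * The total number of balls *)

(** Cauchy condensation: the 2^j terms of indices 2^j to 2^(j+1) - 1 are all at most
    2^(-j s), and their sum is at most rho^j with rho = 2^(1 - s) < 1. *)
Lemma riemann_series_lty (R : realType) (s : R) : 1 < s ->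
  (\sum_(0 <= k <oo) (k.+1%:R `^ (- s))%:E < +oo)%E.
Proof.
move=> s1; pose rho : R := 2 `^ (1 - s).
have rho0 : 0 < rho by rewrite powR_gt0.
have rho1 : rho < 1.
  rewrite -[X in _ < X](powRr0 2) /rho /powR pnatr_eq0 /= ltr_expR.
  by rewrite ltr_pM2r ?ln_gt0 ?ltr1n// subr_lt0.
have nrho : `|rho| < 1 by rewrite gtr0_norm.
have partial j : \sum_(0 <= k < 2 ^ j) k.+1%:R `^ (- s) <=
    1 + series (geometric 1 rho) j :> R.
  elim: j => [|j IH].
    by rewrite expn0 big_nat1 powR1 /series /= big_geq// addr0.
  rewrite (big_cat_nat (n := 2 ^ j)) ?leq_exp2l//= seriesSr addrA lerD//.
  apply: (@le_trans _ _ (\sum_(2 ^ j <= k < 2 ^ j.+1) (2 ^ j)%:R `^ (- s))).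
    apply: ler_sum_nat => k /andP[jk _].
    rewrite !powRN lef_pV2 ?posrE ?powR_gt0 ?ltr0n ?expn_gt0//.
    by rewrite ge0_ler_powR ?nnegrE ?ler_nat ?(leq_trans jk)//; lra.
  rewrite sumr_const_nat expnS mul2n -addnn addnK /= mul1r.
  have -> : rho ^+ j = (2 ^ j)%:R * (2 ^ j)%:R `^ (- s).
    rewrite -[X in _ = X * _]powRr1// -powRD; last first.
      by rewrite pnatr_eq0 expn_eq0 implybT.
    by rewrite natrX -[2%:R ^+ j]powR_mulrn// -powRrM mulrC powRrM powR_mulrn// powR_ge0.
  by rewrite mulr_natl.
apply: (@le_lt_trans _ _ (1 + 1 / (1 - rho))%:E); last exact: ltry.
apply: lime_le; first by apply: is_cvg_nneseries => k _ _; rewrite lee_fin powR_ge0.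
apply: nearW => n; rewrite sumEFin lee_fin.
apply: (@le_trans _ _ (\sum_(0 <= k < 2 ^ n) k.+1%:R `^ (- s))).
  rewrite [leRHS](big_cat_nat (n := n)) ?(ltnW (ltn_expl _ _))//= lerDl.
  by apply: sumr_ge0 => k _; exact: powR_ge0.
by rewrite (le_trans (partial n))// lerD2l geometric_le_lim.
Qed.

Section total.
Context (d : measure_display) (Omega : measurableType d) (R : realType).
Variables (P : probability Omega R) (m W0 B0 : nat) (X xi : nat -> {RV P >-> nat}).
Variables (W B T : nat -> Omega -> nat) (muX : R).
Hypothesis urn : multiple_drawing_urn m W0 B0 X xi W B T.
Hypothesis X_mean : ('E_P[fun w => (X 1%N w)%:R] = muX%:E)%E.
Hypothesis X_variance : ('V_P[fun w => (X 1%N w)%:R] < +oo)%E.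
Local Notation q := (second_moment X).
Local Notation adapted := (adapted X xi).

Definition total_deviation n w : R := (T n w)%:R - m%:R * muX * n%:R.

Definition total_increment (n : nat) (w : Omega) (x k : nat) : R := m%:R * (x%:R - muX).

Let total_variance : R := m%:R ^+ 2 * (q - muX ^+ 2).

Lemma total_deviation_step n w : total_deviation n.+1 w =
  total_deviation n w + total_increment n w (X n.+1 w) (xi n.+1 w).
Proof.
rewrite /total_deviation /total_increment (total_step urn) natrD natrM -natr1.
by ring.
Qed.

Lemma total_deviation_adapted n : adapted n (total_deviation n).
Proof.
move=> w w' hw; rewrite /total_deviation !(urn_total urn).
by have [-> ->] := adapted_WB urn hw.
Qed.

Lemma total_increment_mean n w a :
  one_step_le m X W B muX n (fun w x k => (a + total_increment n w x k) ^+ 2)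
    w (a ^+ 2 + total_variance).
Proof.
pose M : R := m%:R.
exists ((a - M * muX) ^+ 2, 2 * (a - M * muX) * M, M ^+ 2); split=> [x _|]; last first.
  by rewrite /= /total_variance -/M le_eqVlt; apply/orP; left; apply/eqP; ring.
rewrite (next_mean_cst urn _ (c := (a + M * (x%:R - muX)) ^+ 2))//=.
by rewrite le_eqVlt; apply/orP; left; apply/eqP; ring.
Qed.

Lemma total_variance_ge0 : 0 <= total_variance.
Proof. by rewrite mulr_ge0 ?sqr_ge0// (centered_second_moment_ge0 X_mean X_variance). Qed.

(** Dyadic blocks: the event E k controls all times up to 2^(k+2), and its level
    lambda k is at most sqrt n (ln n)^delta for n >= 2^(k+1).  In the bound of
    its probability the powers of 2 cancel up to a factor 2, and k^(-2 delta) is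
    left, which is summable as 2 delta > 1. *)
Lemma total_deviation_bound (delta : R) : 2^-1 < delta ->
  {ae P, forall w, \forall n \near \oo,
    `|total_deviation n w - total_deviation 0 w| <= Num.sqrt n%:R * ln n%:R `^ delta}.
Proof.
move=> delta_gt.
have ln2 : 0 < ln 2 :> R by rewrite ln_gt0// ltr1n.
pose lambda k : R := Num.sqrt (2 ^ k.+1)%:R * (k.+1%:R * ln 2) `^ delta.
have lambda0 k : 0 < lambda k.
  by rewrite mulr_gt0 ?powR_gt0 ?mulr_gt0 ?sqrtr_gt0 ?ltr0n ?expn_gt0.
have exE k := maximal_inequality urn X_mean X_variance total_deviation_step
    total_deviation_adapted (fun n w w' _ => erefl) (v := fun=> total_variance) (fun=> total_variance_ge0)
    total_increment_mean 0 (lambda0 k) (2 ^ k.+2).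
pose E k := projT1 (cid (exE k)).
have mE k : measurable (E k) by rewrite /E; case: cid => ? [].
have PE k : (P (E k) <= (2 * total_variance / ln 2 `^ (2 * delta) * k.+1%:R `^ (- (2 * delta)))%:E)%E.
  rewrite /E; case: cid => ? [_ PE _] /=; apply: le_trans PE _; rewrite lee_fin.
  rewrite big_const_ord iter_addr_0 -[total_variance *+ _]mulr_natl /lambda exprMn sqr_sqrtr//.
  rewrite -powR_mulrn ?powR_ge0// -powRrM [delta * _]mulrC powRM ?(ltW ln2)//.
  rewrite powRN (expnS 2 k.+1) natrM le_eqVlt; apply/orP; left; apply/eqP.
  have N0 : (2 ^ k.+1)%:R != 0 :> R by rewrite pnatr_eq0 expn_eq0.
  have l0 : ln 2 `^ (2 * delta) != 0 :> R by rewrite gt_eqF// powR_gt0.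
  have k0 : k.+1%:R `^ (2 * delta) != 0 :> R by rewrite gt_eqF// powR_gt0.
  by field; rewrite N0 l0 k0.
have EP k w i : (i <= 2 ^ k.+2)%N ->
    lambda k <= `|total_deviation i w - total_deviation 0 w| -> E k w.
  by rewrite /E; case: cid => ? [_ _] /= + i_le le; apply; [exact: i_le|].
have sumE : (\sum_(0 <= k <oo) P (E k) < +oo)%E.
  apply: (@le_lt_trans _ _ (\sum_(0 <= k <oo)
      (2 * total_variance / ln 2 `^ (2 * delta))%:E * (k.+1%:R `^ (- (2 * delta)))%:E)%E).
    by apply: lee_nneseries => // k _; rewrite -EFinM.
  rewrite nneseriesZl; last by move=> k _; rewrite lee_fin powR_ge0.
  rewrite lte_mul_pinfty ?lee_fin//; last by apply: riemann_series_lty; lra.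
  by rewrite divr_ge0 ?powR_ge0// mulr_ge0// total_variance_ge0.
exists (lim_sup_set E); split=> //.
- by apply: bigcapT_measurable => n; apply: bigcup_measurable => k _.
- exact: lim_sup_set_cvg0.
move=> w /=; apply: contra_notP => /existsNP[K /existsNP[_ nE]].
exists (2 ^ K.+1)%N => // n /= Kn.
have n0 : (0 < n)%N by rewrite (leq_trans _ Kn)// expn_gt0.
(* the block that contains n: 2^(k+1) <= n < 2^(k+2) *)
pose k := (trunc_log 2 n).-1.
have logn : (K < trunc_log 2 n)%N by rewrite trunc_log_max.
have kE : k.+1 = trunc_log 2 n by rewrite /k prednK// (leq_trans _ logn).
have /andP[kn nk] := trunc_log_bounds (isT : (1 < 2)%N) n0.
rewrite -kE in kn nk.
have lambda_le : lambda k <= Num.sqrt n%:R * ln n%:R `^ delta.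
  apply: ler_pM; rewrite ?sqrtr_ge0 ?powR_ge0//.
    by rewrite ler_wsqrtr// ler_nat.
  have kln : k.+1%:R * ln 2 <= ln n%:R :> R.
    rewrite mulr_natl -lnXn// ler_ln ?posrE ?exprn_gt0 ?ltr0n//.
    by rewrite -natrX ler_nat.
  apply: ge0_ler_powR => //; rewrite ?nnegrE; first by lra.
    by rewrite mulr_ge0// ltW.
  by rewrite (le_trans _ kln)// mulr_ge0// ltW.
rewrite leNgt; apply/negP => lt; apply: nE.
exists k => /=; first by rewrite -ltnS kE.
apply: (@EP k w n); first exact: ltnW.
exact: le_trans lambda_le (ltW lt).
Qed.

End total.

(** * Calculus of the error terms *)

Section asymptotics.
Variable R : realType.

Lemma near_ln_ge (A : R) : \forall n \near \oo, A <= ln n%:R.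
Proof.
near=> n; rewrite -[leLHS]expRK ler_ln ?posrE ?expR_gt0//; last first.
  by rewrite ltr0n; near: n; exact: nbhs_infty_gt.
by near: n; exact: nbhs_infty_ger.
Unshelve. all: by end_near. Qed.

Lemma near_sqrt_ge (A : R) : \forall n \near \oo, A <= Num.sqrt n%:R.
Proof.
near=> n; rewrite (le_trans (ler_norm A))// -sqrtr_sqr ler_wsqrtr//.
by near: n; exact: nbhs_infty_ger.
Unshelve. all: by end_near. Qed.

(** The exponent delta' < delta leaves a factor (ln n)^(delta' - delta), which
    tends to 0; the constant c is absorbed by sqrt n. *)
Lemma littleo_sqrt_ln (u v : nat -> R) (c delta' delta : R) :
  0 < delta -> delta' < delta ->
  (\forall n \near \oo, `|u n - v n - c| <= Num.sqrt n%:R * ln n%:R `^ delta') ->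
  u = v +o_\oo (fun n => Num.sqrt n%:R * ln n%:R `^ delta).
Proof.
move=> delta0 lt_delta bound; apply/eqaddoP => eps eps0; near=> n.
have ln1 : 1 <= ln n%:R :> R by near: n; exact: near_ln_ge.
have L1 : 1 <= ln n%:R `^ delta :> R.
  by have := ler_powR ln1 (ltW delta0); rewrite powRr0.
have L0 : 0 < ln n%:R `^ delta :> R by rewrite (lt_le_trans _ L1).
have eps2 : 0 < eps / 2 by rewrite divr_gt0.
rewrite [`|_ * _|]ger0_norm ?mulr_ge0 ?sqrtr_ge0 ?powR_ge0//.
rewrite (_ : (u - v) n = (u n - v n - c) + c); last by rewrite subrK.
rewrite (le_trans (ler_normD _ _))// [in leRHS](splitr eps) mulrDl lerD//.
  apply: (@le_trans _ _ (Num.sqrt n%:R * ln n%:R `^ delta')); first by near: n.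
  rewrite mulrCA ler_wpM2l ?sqrtr_ge0// -[delta](subrK delta').
  rewrite powRD; last by rewrite (gt_eqF (lt_le_trans ltr01 ln1)) implybT.
  rewrite mulrA ler_peMl ?powR_ge0// -ler_pdivrMl// mulr1.
  have e0 : 0 < delta - delta' by rewrite subr_gt0.
  have -> : (eps / 2)^-1 = ((eps / 2)^-1 `^ (delta - delta')^-1) `^ (delta - delta').
    by rewrite -powRrM mulVf ?gt_eqF// powRr1// invr_ge0 ltW.
  apply: ge0_ler_powR; rewrite ?nnegrE ?powR_ge0 ?(ltW e0)//.
    exact: le_trans ln1.
  by near: n; exact: near_ln_ge.
rewrite mulrA (@le_trans _ _ (eps / 2 * Num.sqrt n%:R))//.
  by rewrite -ler_pdivrMl//; near: n; exact: near_sqrt_ge.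
by rewrite ler_peMr// mulr_ge0 ?sqrtr_ge0// ltW.
Unshelve. all: by end_near. Qed.

(** As ln n = 2 ln (sqrt n) < 2 sqrt n, one has sqrt n ln n <= 2 n. *)
Lemma littleo_linear (u v : nat -> R) :
  u = v +o_\oo (fun n => Num.sqrt n%:R * ln n%:R `^ 1) ->
  u = v +o_\oo (fun n => n%:R : R).
Proof.
move=> /eqaddoP uv; apply/eqaddoP => eps eps0.
have eps2 : 0 < eps / 2 by rewrite divr_gt0.
near=> n; have ln1 : 1 <= ln n%:R :> R by near: n; exact: near_ln_ge.
have n0 : 0 < n%:R :> R by rewrite ltr0n; near: n; exact: nbhs_infty_gt.
have s0 : 0 < Num.sqrt n%:R :> R by rewrite sqrtr_gt0.
apply: (@le_trans _ _ (eps / 2 * `|Num.sqrt n%:R * ln n%:R `^ 1|)).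
  by near: n; exact: (uv _ eps2).
rewrite powRr1 ?(le_trans _ ln1)// !ger0_norm//; last first.
  by rewrite mulr_ge0 ?sqrtr_ge0// (le_trans _ ln1).
rewrite -mulrA ler_pM2l// ler_pdivrMl//.
have -> : ln n%:R = 2 * ln (Num.sqrt n%:R) :> R.
  by rewrite -[in LHS](sqr_sqrtr (ltW n0)) lnXn// mulr_natl.
rewrite mulrCA ler_pM2l// -[leRHS](sqr_sqrtr (ltW n0)) expr2 ler_pM2l//.
exact/ltW/ln_sublinear.
Unshelve. all: by end_near. Qed.

(** z t - a l n = z (t - a n) + a (z - l) n. *)
Lemma littleo_product (z t : nat -> R) (l a : R) :
  (forall n, 0 <= z n <= 1) -> z n @[n --> \oo] --> l ->
  t = (fun n => a * n%:R) +o_\oo (fun n => n%:R : R) ->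
  (fun n => z n * t n) = (fun n => a * l * n%:R) +o_\oo (fun n => n%:R : R).
Proof.
move=> z01 /cvgrPdist_le zl /eqaddoP ta; apply/eqaddoP => eps eps0.
have eps2 : 0 < eps / 2 by rewrite divr_gt0.
have a1 : 0 < `|a| + 1 by rewrite ltr_wpDl.
near=> n.
rewrite (_ : (_ - _) n = z n * (t n - a * n%:R) + a * (z n - l) * n%:R); last first.
  by transitivity (z n * t n - a * l * n%:R) => //; ring.
rewrite (le_trans (ler_normD _ _))// [in leRHS](splitr eps) mulrDl lerD//.
  rewrite normrM (@le_trans _ _ `|t n - a * n%:R|)//.
    by rewrite ler_piMl// ger0_norm; have /andP[] := z01 n.
  by near: n; exact: (ta _ eps2).
rewrite !normrM ler_wpM2r//.
apply: (@le_trans _ _ ((`|a| + 1) * (eps / 2 / (`|a| + 1)))).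
  apply: ler_pM => //; first by rewrite lerDl.
  by rewrite distrC; near: n; apply: zl; rewrite divr_gt0.
by rewrite mulrC divfK// gt_eqF.
Unshelve. all: by end_near. Qed.

Lemma littleo_sub (u v u' v' e : nat -> R) :
  u = v +o_\oo e -> u' = v' +o_\oo e ->
  (fun n => u n - u' n) = (fun n => v n - v' n) +o_\oo e.
Proof.
move=> /eqaddoP uv /eqaddoP uv'; apply/eqaddoP => eps eps0.
have eps2 : 0 < eps / 2 by rewrite divr_gt0.
have := uv _ eps2; have := uv' _ eps2; apply: filterS2 => n le' le.
rewrite (_ : (_ - _) n = (u n - v n) - (u' n - v' n)); last first.
  by transitivity (u n - u' n - (v n - v' n)) => //; ring.
by rewrite (le_trans (ler_normB _ _))// [in leRHS](splitr eps) mulrDl lerD.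
Qed.

End asymptotics.

(** * The asymptotics of the urn *)

Theorem theorem2 (d : measure_display) (Omega : measurableType d)
    (R : realType) (P : probability Omega R)
    (m W0 B0 : nat) (X xi : nat -> {RV P >-> nat})
    (W B T : nat -> Omega -> nat) (muX : R)
    (urn : multiple_drawing_urn m W0 B0 X xi W B T)
    (X_mean : ('E_P[fun w => (X 1%N w)%:R] = muX%:E)%E)
    (X_variance : ('V_P[fun w => (X 1%N w)%:R] < +oo)%E) :
  exists Winf : {RV P >-> R},
    [/\ forall w, 0 <= Winf w,
        ((0 < W0)%N -> forall w, 0 < Winf w) &
        {ae P, forall w,
          [/\ forall delta : R, 2^-1 < delta ->
                (fun n => (T n w)%:R) = (fun n => m%:R * muX * n%:R)
                  +o_\oo (fun n => Num.sqrt n%:R * ln n%:R `^ delta),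
              (fun n => (W n w)%:R) = (fun n => Winf w * n%:R)
                  +o_\oo (fun n => n%:R : R) &
              (fun n => (B n w)%:R) = (fun n => (m%:R * muX - Winf w) * n%:R)
                  +o_\oo (fun n => n%:R : R)]}].
Proof.
pose Z n w : R := proportion R W T n w.
have Z01 n w : 0 <= Z n w <= 1 by rewrite proportion_ge0 (proportion_le1 urn).
pose Zinf w := limn_sup (Z ^~ w).
pose a : R := m%:R * muX.
have a0 : 0 < a.
  rewrite mulr_gt0 ?ltr0n ?(urn_m_gt0 urn)//.
  exact: lt_le_trans ltr01 (muX_ge1 urn X_mean).
(* The limit proportion may vanish on a null set, on which the value is changed so
   as to make the limit positive everywhere when W0 > 0. *)
pose Wlim w := if 0 < Zinf w then a * Zinf w else (0 < W0)%N%:R.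
have mZinf : measurable_fun setT Zinf.
  apply: measurable_fun_limn_sup => [w _|w _|n].
  - by exists 1 => _ [n _ <-]; have /andP[] := Z01 n w.
  - by exists 0 => _ [n _ <-]; have /andP[] := Z01 n w.
  - exact: (adapted_measurable (proportion_adapted urn (n := n))).
have mWlim : measurable_fun setT Wlim.
  apply: measurable_fun_ifT => //; last exact: measurable_funM.
  exact: measurable_fun_ltr.
pose Winf : {RV P >-> R} := HB.pack Wlim (isMeasurableFun.Build _ _ _ _ Wlim mWlim).
exists Winf; split=> [w|W0_gt0 w|].
- by rewrite /Winf /= /Wlim; case: ifPn => [/ltW ?|//]; rewrite mulr_ge0// ltW.
- by rewrite /Winf /= /Wlim W0_gt0; case: ifPn => // ?; rewrite mulr_gt0.
have Zcvg := proportion_cvg urn X_mean X_variance.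
have Znot0 : {ae P, forall w, (0 < W0)%N -> ~ (Z n w @[n --> \oo] --> 0)}.
  have [W0_gt0|] := boolP (0 < W0)%N; last by move=> _; apply: aeW.
  have := proportion_not_cvg0 urn X_mean X_variance W0_gt0.
  exact: filterS.
(* Countably many exponents, decreasing to 1/2, suffice for all delta > 1/2. *)
have dev : {ae P, forall w j, \forall n \near \oo,
    `|total_deviation m T muX n w - total_deviation m T muX 0 w| <=
      Num.sqrt n%:R * ln n%:R `^ (2^-1 + j.+1%:R^-1)}.
  apply: ae_foralln => j.
  by apply: (total_deviation_bound urn X_mean X_variance); rewrite ltrDl invr_gt0.
move: Zcvg Znot0 dev; apply: filterS3 => w Zcvg Znot0 dev.
have Tn (delta : R) : 2^-1 < delta ->
    (fun n => (T n w)%:R) = (fun n => a * n%:R)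
      +o_\oo (fun n => Num.sqrt n%:R * ln n%:R `^ delta).
  move=> lt_delta; have gap : 0 < delta - 2^-1 by rewrite subr_gt0.
  near \oo => j.
  apply: (@littleo_sqrt_ln _ _ _ (total_deviation m T muX 0 w) (2^-1 + j.+1%:R^-1)).
  - by rewrite (lt_trans _ lt_delta)// invr_gt0.
  - rewrite addrC -ltrBrDr; near: j; exact: (near_infty_natSinv_lt (PosNum gap)).
  - exact: dev.
have TN : (fun n => (T n w)%:R) = (fun n => a * n%:R) +o_\oo (fun n => n%:R : R).
  by apply: littleo_linear; apply: Tn; rewrite invf_lt1// ltr1n.
have ZN : Z n w @[n --> \oo] --> Zinf w.
  by rewrite /Zinf cvg_limn_supE.
have WlimE : Wlim w = a * Zinf w.
  rewrite /Wlim; case: ifPn => //; rewrite -leNgt => le0.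
  have Z0 : Zinf w = 0.
    apply/eqP; rewrite eq_le le0 -(cvg_lim _ ZN)//=; apply: limr_ge => //.
    by apply: nearW => n; have /andP[] := Z01 n w.
  rewrite Z0 mulr0; case: ltnP => // W0_gt0.
  by case: (Znot0 W0_gt0); rewrite -[X in _ --> X]Z0.
have WN : (fun n => (W n w)%:R) = (fun n => Winf w * n%:R) +o_\oo (fun n => n%:R : R).
  rewrite /Winf /= WlimE.
  suff <- : (fun n => Z n w * (T n w)%:R) = (fun n => (W n w)%:R).
    exact: littleo_product (Z01 ^~ w) ZN TN.
  apply/funext => n; rewrite /Z /proportion divfK//.
  by rewrite pnatr_eq0 -lt0n (total_gt0 urn).
split=> //.
have <- : (fun n => (T n w)%:R - (W n w)%:R) = (fun n => (B n w)%:R : R).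
  by apply/funext => n; rewrite (urn_total urn) natrD addrC addKr.
have <- : (fun n => a * n%:R - Winf w * n%:R) = (fun n => (a - Winf w) * n%:R).
  by apply/funext => n; rewrite mulrBl.
exact: littleo_sub TN WN.
Unshelve. all: by end_near. Qed.
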